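(* Let $\alpha\in(0,1)$, $a_1,a_2\in\mathbb{R}$, and let $A$ be the $N\times N$ matrix defined below with $a_0=-a_2$. Let $\Omega_\alpha$ be the bounded open region enclosed by the curve $\beta(t)=1+e^{it}(1-e^{-it})^{\alpha}$, $0\le t\le 2\pi$, and let $R_N$ be the set of $(a_1,a_2)\in\mathbb{R}^2$ such that every eigenvalue of $A$ lies in $\Omega_\alpha$ (the stable region of the zero solution). For $j$ with $\sin(2\pi j/N)\neq 0$ let $\gamma_j$ be the closed curve in the $a_1a_2$-plane $$\gamma_j(t)=\left(\mathrm{Re}\!\left[e^{it}(1-e^{-it})^{\alpha}\right]+1,\ \frac{1}{2\sin(2\pi j/N)}\,\mathrm{Im}\!\left[e^{it}(1-e^{-it})^{\alpha}\right]\right),\quad 0\le t\le 2\pi .$$ Then: (i) if $N=1$ or $N=2$, $R_N=\{(a_1,a_2): 1-2^{\alpha}<a_1<1\}$; (ii) if $N\ge 3$ is odd, $R_N$ is the region bounded by the line $a_1=1$ and the curve $\gamma_{j^*}$ with $j^*=\lceil (N-1)/4\rceil$, i.e. the set of points with $a_1<1$ lying inside $\gamma_{j^*}$; (iii) if $N\ge 4$ is even, $R_N$ is the region bounded by the line $a_1=1$ and the curve $\gamma_{j^*}$ with $j^*=\lfloor N/4\rfloor$, i.e. the set of points with $a_1<1$ lying inside $\gamma_{j^*}$.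
   Context: Fractional-order linear coupled map lattice: for $\alpha\in(0,1)$, $X_{t+1}=X_0+\sum_{j=0}^{t}\frac{\Gamma(t-j+\alpha)}{\Gamma(\alpha)\Gamma(t-j+1)}(A-I)X_j$, $X_t\in\mathbb{R}^N$. Connectivity matrix for $N\ge 3$: $A$ is the $N\times N$ circulant matrix with $A_{k,k}=a_1$, $A_{k,k+1}=a_2$, $A_{k,k-1}=a_0$ (indices modulo $N$, periodic boundary conditions), all other entries $0$; for $N=2$, $A=\begin{pmatrix}a_1&a_0+a_2\\ a_0+a_2&a_1\end{pmatrix}$; for $N=1$, $A=(a_0+a_1+a_2)$. Powers $(1-e^{-it})^\alpha$ use the principal branch. By the stability criterion, the zero solution is asymptotically stable exactly when every eigenvalue of $A$ lies in $\Omega_\alpha$; a real number lies in $\Omega_\alpha$ iff it lies in $(1-2^{\alpha},1)$. $\lceil\cdot\rceil$ and $\lfloor\cdot\rfloor$ denote ceiling and integer part. *)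

(* Defs.v *)
From HB Require Import structures.
From mathcomp Require Import all_boot all_order all_algebra.
From mathcomp Require Import complex.
From mathcomp Require Import all_classical all_reals all_analysis.
From mathcomp Require Import Rstruct Rstruct_topology.
From Stdlib Require Import Rdefinitions.
Set Implicit Arguments. Unset Strict Implicit. Unset Printing Implicit Defensive.
Import Order.TTheory GRing.Theory Num.Theory.
Local Open Scope ring_scope.
Local Open Scope classical_set_scope.

Notation Real := Rdefinitions.R.

Definition cmul (z w : Real * Real) : Real * Real :=
  (z.1 * w.1 - z.2 * w.2, z.1 * w.2 + z.2 * w.1).

Definition cexpi (t : Real) : Real * Real := (cos t, sin t).

(* principal argument, in (-pi, pi] (atan2); arg 0 := 0 *)
Definition carg (z : Real * Real) : Real :=
  let: (x, y) := z in
  if 0 < x then atan (y / x)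
  else if x < 0 then (if 0 <= y then atan (y / x) + pi else atan (y / x) - pi)
  else if 0 < y then pi / 2
  else if y < 0 then - (pi / 2)
  else 0.

(* principal power z^a = exp(a Log z) = |z|^a e^{i a Arg z}, with 0^a = 0 (a > 0) *)
Definition cpow (z : Real * Real) (a : Real) : Real * Real :=
  if z == (0, 0) then (0, 0)
  else let r := Num.sqrt (z.1 ^+ 2 + z.2 ^+ 2) in
       (r `^ a * cos (a * carg z), r `^ a * sin (a * carg z)).

(* e^{it} (1 - e^{-it})^alpha *)
Definition kern (alpha t : Real) : Real * Real :=
  cmul (cexpi t) (cpow (1 - cos t, sin t) alpha).

Definition beta (alpha t : Real) : Real * Real :=
  (1 + (kern alpha t).1, (kern alpha t).2).

Definition gamma (alpha : Real) (N j : nat) (t : Real) : Real * Real :=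
  ((kern alpha t).1 + 1,
   (kern alpha t).2 / (2 * sin (2 * pi * j%:R / N%:R))).

Definition curve_image (c : Real -> Real * Real) : set (Real * Real) :=
  [set z | exists2 t, 0 <= t <= 2 * pi & c t = z].

Definition bounded_plane (S : set (Real * Real)) : Prop :=
  exists M : Real, forall z, S z -> `|z.1| <= M /\ `|z.2| <= M.

Definition enclosed (c : Real -> Real * Real) : set (Real * Real) :=
  [set z | ~ curve_image c z /\
           bounded_plane (connected_component (~` curve_image c) z)].

Definition Omega (alpha : Real) : set (Real * Real) := enclosed (beta alpha).

Definition Amat (N : nat) (a0 a1 a2 : Real) : 'M[Real]_N :=
  \matrix_(i < N, j < N)
    if N == 1%N then a0 + a1 + a2
    else if N == 2%N then (if i == j then a1 else a0 + a2)
    else if (j : nat) == i then a1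
    else if (j : nat) == modn (i : nat).+1 N then a2
    else if (i : nat) == modn (j : nat).+1 N then a0
    else 0.

Local Open Scope complex_scope.

Definition is_eigenvalue (N : nat) (A : 'M[Real]_N) (l : Real[i]) : bool :=
  eigenvalue (map_mx (real_complex Real) A) l.

Definition stable_region (alpha : Real) (N : nat) : set (Real * Real) :=
  [set p | forall l : Real[i], is_eigenvalue (Amat N (- p.2) p.1 p.2) l ->
             Omega alpha (complex.Re l, complex.Im l)].

(* Main.v *)
(** Writing [1 - e^{-it} = 2 sin(t/2) e^{i(pi - t)/2}], the reflected curve [1 - beta(t)] is, in polar coordinates, [r = (2 cos(theta / (2 - alpha)))^alpha] with [|theta| <= pi (1 - alpha/2)]. It bounds a region that is star-shaped about its centre, namely the points other than the centre where [2 cos(|theta| / (2 - alpha)) > r^(1/alpha)]. For [a1 < 1] this condition survives lowering the modulus of the imaginary part, since both [r] and [|theta|] then decrease. When [a0 = -a2], discrete Fourier analysis gives the eigenvalues [a1 + 2 i a2 sin(2 pi k / N)] of [A]. So stability amounts to [a1 < 1], from [k = 0], together with the condition for the [k] that maximises [|sin(2 pi k / N)|], which is [j*]; the curve [gamma_{j*}] is [beta] with its ordinate divided by [2 sin(2 pi j* / N)]. *)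

Require Import Defs.
From HB Require Import structures.
From mathcomp Require Import all_boot all_order all_algebra.
From mathcomp Require Import complex.
From mathcomp Require Import all_classical all_reals all_analysis.
From mathcomp Require Import Rstruct Rstruct_topology.
From mathcomp Require Import ring lra.
From mathcomp Require Import zify.
Import Order.TTheory GRing.Theory Num.Theory.
Import numFieldNormedType.Exports.
Local Open Scope ring_scope.
Local Open Scope classical_set_scope.

Set Implicit Arguments. Unset Strict Implicit. Unset Printing Implicit Defensive.

Local Notation RR := Rdefinitions.R.

(** * The curve in polar coordinates *)

Lemma cos_double_half (R : realType) (t : R) : cos t = 1 - 2 * sin (t / 2) ^+ 2.
Proof.
have -> : cos t = cos ((t / 2) *+ 2) by congr cos; rewrite mulr2n; lra.
rewrite cos_mulr2n; have := cos2Dsin2 (t / 2); lra.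
Qed.

Lemma sin_double_half (R : realType) (t : R) :
  sin t = 2 * sin (t / 2) * cos (t / 2).
Proof.
have -> : sin t = sin ((t / 2) *+ 2) by congr sin; rewrite mulr2n; lra.
by rewrite sin_mulr2n mulr2n; ring.
Qed.

(** The real part is positive, so only the [atan] branch matters; the slope is the cotangent of
    [t / 2], the tangent of an angle inside [(-pi/2, pi/2)]. *)
Lemma carg_one_minus_expN (t : RR) :
  0 < t < 2 * pi -> carg (1 - cos t, sin t) = (pi - t) / 2.
Proof.
move=> t02; have st : 0 < sin (t / 2) by apply: sin_gt0_pi; lra.
have x_gt0 : 0 < 1 - cos t.
  by have := exprn_gt0 2 st; rewrite (cos_double_half t); lra.
rewrite /carg x_gt0.
have -> : sin t / (1 - cos t) = tan ((pi - t) / 2).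
  have -> : (pi - t) / 2 = - (t / 2 - pi / 2) :> RR by lra.
  rewrite /tan sinN cosN cosBpihalf sinBpihalf opprK.
  rewrite (cos_double_half t) (sin_double_half t).
  by field; rewrite gt_eqF //=; have := exprn_gt0 2 st; lra.
by rewrite tanK // in_itv /=; lra.
Qed.

(* [1 - e^{-it} = 2 sin(t/2) e^{i(pi - t)/2}]; the argument is measured from the negative real axis, about which the curve is symmetric. *)
Lemma kern_polar (alpha t : RR) : 0 < alpha -> 0 <= t <= 2 * pi ->
  let r := (2 * sin (t / 2)) `^ alpha in
  let theta := (t - pi) * (1 - alpha / 2) in
  kern alpha t = (- (r * cos theta), - (r * sin theta)).
Proof.
move=> a0 t02 /=.
have alpha0 : alpha != 0 by rewrite gt_eqF.
(* At the endpoints [0] and [2 * pi] the base vanishes, and [cpow] and [powR] both return zero. *)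
have [t0 | tn0] := eqVneq (sin (t / 2)) 0.
  rewrite t0 mulr0 powR0 // !mul0r oppr0.
  rewrite /kern /cpow (cos_double_half t) (sin_double_half t) t0.
  rewrite expr0n /= !mulr0 mul0r subr0 subrr eqxx /cmul /=.
  by rewrite !mulr0 subr0 addr0.
have [tp t2p] : 0 < t /\ t < 2 * pi.
  case/andP: t02; rewrite !le_eqVlt => /predU1P[t0|->] /predU1P[t2|->] //.
  - by move: tn0; rewrite -t0 mul0r sin0 eqxx.
  - by move: tn0; rewrite -t0 mul0r sin0 eqxx.
  - move: tn0; rewrite t2; have -> : 2 * pi / 2 = pi :> RR by lra.
    by rewrite sinpi eqxx.
have st : 0 < sin (t / 2) by apply: sin_gt0_pi; lra.
have x_gt0 : 0 < 1 - cos t.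
  by have := exprn_gt0 2 st; rewrite (cos_double_half t); lra.
rewrite /kern /cpow -pair_eqE [pair_eq _ _]/= gt_eqF //.
rewrite carg_one_minus_expN ?tp //=.
have -> : Num.sqrt ((1 - cos t) ^+ 2 + sin t ^+ 2) = 2 * sin (t / 2).
  rewrite -[RHS]gtr0_norm ?mulr_gt0 // -sqrtr_sqr; congr Num.sqrt.
  have := cos2Dsin2 t; rewrite (cos_double_half t); lra.
rewrite /cmul /cexpi /=.
set r := _ `^ _; set psi := alpha * _.
have -> : (t - pi) * (1 - alpha / 2) = (t + psi) - pi by rewrite /psi; lra.
have cospi' x : cos (x - pi) = - cos x :> RR.
  by rewrite -[in RHS](subrK pi x) cosDpi opprK.
have sinpi' x : sin (x - pi) = - sin x :> RR.
  by rewrite -[in RHS](subrK pi x) sinDpi opprK.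
by rewrite cospi' sinpi' trigo.cosD trigo.sinD; congr pair; ring.
Qed.

(** * The level function and its polar form *)

Definition modulus (w : RR * RR) : RR := Num.sqrt (w.1 ^+ 2 + w.2 ^+ 2).

(** The [acos] is the absolute value of the polar angle. At the centre, [0 / 0 = 0] gives angle
    [pi / 2] and, for [0 < alpha < 1], a positive level although the curve passes there; hence the
    separate clause [w != (0, 0)] later. *)
Definition level (alpha : RR) (w : RR * RR) : RR :=
  2 * cos (acos (w.1 / modulus w) / (2 - alpha)) - modulus w `^ alpha^-1.

Lemma modulus_ge0 w : 0 <= modulus w.
Proof. exact: sqrtr_ge0. Qed.

Lemma modulus_eq0 w : (modulus w == 0) = (w == (0, 0)).
Proof.
rewrite sqrtr_eq0 -pair_eqE /=; apply/idP/andP.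
  move=> h; have /andP[h1 h2] : (w.1 ^+ 2 == 0) && (w.2 ^+ 2 == 0).
    by rewrite -paddr_eq0 ?sqr_ge0 // eq_le h addr_ge0 ?sqr_ge0.
  by split; rewrite -sqrf_eq0.
by case=> /eqP-> /eqP->; rewrite expr0n /= addr0.
Qed.

Lemma modulus_gt0 w : w != (0, 0) -> 0 < modulus w.
Proof. by move=> w0; rewrite lt_def modulus_ge0 modulus_eq0 w0. Qed.

Lemma sqr_modulus w : modulus w ^+ 2 = w.1 ^+ 2 + w.2 ^+ 2.
Proof. by rewrite sqr_sqrtr // addr_ge0 ?sqr_ge0. Qed.

Lemma norm_fst_le_modulus w : `|w.1| <= modulus w.
Proof. by rewrite -sqrtr_sqr ler_wsqrtr // lerDl sqr_ge0. Qed.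

Lemma norm_snd_le_modulus w : `|w.2| <= modulus w.
Proof. by rewrite -sqrtr_sqr ler_wsqrtr // lerDr sqr_ge0. Qed.

Lemma fst_div_modulus_bound w : -1 <= w.1 / modulus w <= 1.
Proof.
rewrite -ler_norml normrM normfV (ger0_norm (modulus_ge0 w)).
have [->|w0] := eqVneq w (0, 0); first by rewrite normr0 mul0r.
by rewrite ler_pdivrMr ?modulus_gt0 // mul1r norm_fst_le_modulus.
Qed.

Lemma modulus_polar (r theta : RR) : 0 <= r ->
  modulus (r * cos theta, r * sin theta) = r.
Proof.
move=> r0; rewrite /modulus /= !exprMn -mulrDr cos2Dsin2 mulr1 sqrtr_sqr.
exact: ger0_norm.
Qed.

(** The sign of [theta] lost by [acos] is immaterial because cosine is even. *)
Lemma level_polar (alpha r theta : RR) : 0 < r -> `|theta| <= pi ->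
  level alpha (r * cos theta, r * sin theta)
  = 2 * cos (theta / (2 - alpha)) - r `^ alpha^-1.
Proof.
move=> r0 tpi; rewrite /level modulus_polar ?(ltW r0) //= mulrAC divff ?gt_eqF //.
rewrite mul1r; congr (2 * _ - _).
have [t0|t0] := leP 0 theta.
  by rewrite cosK // in_itv /= t0 -[theta]ger0_norm.
rewrite cosKN ?mulNr ?cosN //.
by move: tpi; rewrite ltr0_norm //; lra.
Qed.

Lemma polarP (w : RR * RR) : w != (0, 0) -> exists2 theta,
  `|theta| <= pi & w = (modulus w * cos theta, modulus w * sin theta).
Proof.
move=> w0; have m0 := modulus_gt0 w0; have b := fst_div_modulus_bound w.
have th0 := acos_ge0 b; have thpi := acos_lepi b.
set th := acos _ in th0 thpi.
have u_eq : w.1 = modulus w * cos th.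
  by rewrite acosK ?in_itv //= mulrC divfK ?gt_eqF.
have v_eq : `|w.2| = modulus w * sin th.
  rewrite -[RHS]ger0_norm ?mulr_ge0 ?(ltW m0) ?sin_ge0_pi ?th0 //.
  apply/eqP; rewrite -(@eqrXn2 _ 2) // -!normrX !ger0_norm ?sqr_ge0 //.
  by apply/eqP; rewrite exprMn sin2cos2 mulrBr mulr1 -exprMn -u_eq sqr_modulus; ring.
have [v0|v0] := leP 0 w.2.
  exists th; first by rewrite ger0_norm.
  by rewrite -u_eq -v_eq ger0_norm //; case: w {w0 m0 b th0 thpi th u_eq v_eq v0}.
exists (- th); first by rewrite normrN ger0_norm.
rewrite cosN sinN mulrN -u_eq -v_eq ltr0_norm // opprK.
by case: w {w0 m0 b th0 thpi th u_eq v_eq v0}.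
Qed.

Lemma kern_imageP (alpha u v : RR) : 0 < alpha < 1 ->
  (exists2 t, 0 <= t <= 2 * pi & kern alpha t = (- u, v)) <->
  (u, v) = (0, 0) \/ level alpha (u, v) = 0.
Proof.
move=> /andP[a0 a1]; have b0 : 0 < 2 - alpha by lra.
have pi0 : 0 < (pi : RR) by exact: pi_gt0.
split=> [[t t02]|].
  rewrite kern_polar //; set th := (t - pi) * _; set r := _ `^ _.
  case=> /oppr_inj <- <-.
  have -> : - (r * sin th) = r * sin (- th) by rewrite sinN mulrN.
  have -> : r * cos th = r * cos (- th) by rewrite cosN.
  have [r0|r0] := eqVneq r 0; first by left; rewrite r0 !mul0r.
  have s_ge0 : 0 <= sin (t / 2) by apply: sin_ge0_pi; lra.
  right; rewrite level_polar.
  - rewrite -powRrM divff ?gt_eqF // powRr1 ?mulr_ge0 //.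
    have -> : - th / (2 - alpha) = pi / 2 - t / 2.
      by rewrite /th; field; rewrite gt_eqF.
    by rewrite trigo.cosD cosN sinN cos_pihalf sin_pihalf; ring.
  - by rewrite lt_def r0 powR_ge0.
  - rewrite normrN ler_norml /th; nra.
have kern0 : exists2 t, 0 <= t <= 2 * pi & kern alpha t = (- 0, 0).
  exists 0; first by lra.
  rewrite kern_polar //; last by lra.
  by rewrite mul0r sin0 mulr0 powR0 ?gt_eqF // !mul0r oppr0.
case=> [[-> ->] //|].
have [[-> ->] //|w0] := eqVneq (u, v) (0, 0).
have [th thpi uv] := polarP w0.
have m0 := modulus_gt0 w0; set m := modulus _ in uv m0.
rewrite uv level_polar // => /eqP; rewrite subr_eq0 => /eqP lvl.
(* A positive cosine confines [th / (2 - alpha)] to [(-pi/2, pi/2)], which is what puts the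
   parameter chosen below in [[0, 2 * pi]]. *)
have c0 : 0 < cos (th / (2 - alpha)).
  by have := powR_gt0 alpha^-1 m0; rewrite -lvl; lra.
have thlt : `|th / (2 - alpha)| < pi / 2.
  rewrite ltNge; apply/negP => hge.
  have thle : `|th / (2 - alpha)| <= pi.
    rewrite normrM normfV (gtr0_norm b0) ler_pdivrMr //; nra.
  have cabs : cos `|th / (2 - alpha)| = cos (th / (2 - alpha)).
    by case: (ger0P (th / (2 - alpha))) => // _; rewrite cosN.
  have := sin_ge0_pi (x := `|th / (2 - alpha)| - pi / 2).
  rewrite sinBpihalf cabs => h; have := h _; lra.
(* The solution [t] of [(t - pi) * (1 - alpha / 2) = - th]; the minus sign comes from the reflected
   abscissa. *)
exists (pi - 2 * (th / (2 - alpha))).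
  by move: thlt; rewrite ltr_norml; lra.
rewrite kern_polar //; last by move: thlt; rewrite ltr_norml; lra.
have -> : (pi - 2 * (th / (2 - alpha)) - pi) * (1 - alpha / 2) = - th.
  by field; rewrite gt_eqF.
have -> : (pi - 2 * (th / (2 - alpha))) / 2 = - (th / (2 - alpha) - pi / 2).
  by lra.
rewrite sinN sinBpihalf opprK lvl -powRrM mulVf ?gt_eqF // powRr1 ?(ltW m0) //.
by rewrite cosN sinN mulrN opprK; case: uv => <- <-.
Qed.

(** * The enclosed region *)

Lemma acos_within_continuous (R : realType) :
  {within `[(-1 : R), 1]%classic, continuous (@acos R)}.
Proof.
rewrite -[X in `[X, _]%classic]cospi -[X in `[_, X]%classic]cos0.
apply: segment_can_ge_continuous; first exact: pi_ge0.
- by apply: continuous_subspaceT => x; exact: continuous_cos.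
- exact: cosK.
Qed.

(** Continuity of [acos] is available within [[-1, 1]] only, so [h] has to take all its values
    there. *)
Lemma cvg_acos (R : realType) (T : topologicalType) (h : T -> R) (x : T) :
  (forall y, -1 <= h y <= 1) -> {for x, continuous h} ->
  {for x, continuous (acos \o h)}.
Proof.
move=> hb hc P /= nP.
have hx : (`[(-1 : R), 1]%classic : set R) (h x) by rewrite /= in_itv /=.
have := acos_within_continuous nP.
rewrite /nbhs /= -nbhs_subspace_in // => wP.
have := hc _ wP; rewrite /nbhs /=; apply: filterS => y /=; apply.
by rewrite in_itv /=; exact: hb.
Qed.

Lemma continuous_powR (R : realType) (p x : R) : 0 < x ->
  {for x, continuous (fun y => y `^ p)}.
Proof.
move=> x0; apply/differentiable_continuous/derivable1_diffP.
exact: (@ex_derive _ _ _ _ _ _ _ (is_derive1_powR p x0)).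
Qed.

Lemma modulus_continuous : continuous modulus.
Proof.
have -> : modulus = Num.sqrt \o (fun w => w.1 * w.1 + w.2 * w.2) by [].
move=> w; apply: continuous_comp; last exact: sqrt_continuous.
by apply: cvgD; apply: cvgM; first [exact: cvg_fst|exact: cvg_snd].
Qed.

Lemma level_continuous (alpha : RR) (w : RR * RR) : w != (0, 0) ->
  {for w, continuous (level alpha)}.
Proof.
move=> w0; have m0 := modulus_gt0 w0.
pose theta (w : RR * RR) : RR := acos (w.1 / modulus w).
have theta_cont : {for w, continuous theta}.
  apply: (cvg_acos (h := fun w : RR * RR => w.1 / modulus w) (x := w)).
    exact: fst_div_modulus_bound.
  apply: cvgM; first exact: cvg_fst.
  by apply: cvgV; [rewrite gt_eqF|exact: modulus_continuous].
have cos_cont : {for w, continuous (fun w => cos (theta w / (2 - alpha)))}.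
  apply: (@continuous_comp _ _ _ (fun w => theta w / (2 - alpha)) cos);
    last exact: continuous_cos.
  by apply: cvgM; [exact: theta_cont|exact: cvg_cst].
have pow_cont : {for w, continuous (fun w => modulus w `^ alpha^-1)}.
  apply: (@continuous_comp _ _ _ modulus (fun y => y `^ alpha^-1)).
    exact: modulus_continuous.
  exact: continuous_powR.
by apply: cvgB pow_cont; apply: cvgM cos_cont; exact: cvg_cst.
Qed.

Lemma continuous_subr (R : realType) (T : topologicalType) (c : R) (f : T -> R) x :
  {for x, continuous f} -> {for x, continuous (fun y => c - f y)}.
Proof. by move=> cf; apply: cvgB cf; exact: cvg_cst. Qed.

Lemma continuous_mulr (R : realType) (b : R) : continuous (fun s : R => s * b).
Proof. by move=> s; apply: cvgM; [exact: cvg_id|exact: cvg_cst]. Qed.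

Lemma continuous_one_sub_mulr (R : realType) (b : R) :
  continuous (fun s : R => 1 - s * b).
Proof.
by move=> s; apply: cvgB; [exact: cvg_cst|exact: continuous_mulr].
Qed.

Lemma continuous_affine_ray (R : realType) (a b : R) :
  continuous (fun s : R => (1 - s * a, s * b)).
Proof.
move=> s; pose f (s : R) : R := 1 - s * a; pose g (s : R) : R := s * b.
have cf : {for s, continuous f} by exact: continuous_one_sub_mulr.
have cg : {for s, continuous g} by exact: continuous_mulr.
exact: (cvg_pair cf cg).
Qed.

Definition recenter (k : RR) (z : RR * RR) : RR * RR := (1 - z.1, z.2 / k).

Lemma recenter_continuous k : continuous (recenter k).
Proof.
move=> z.
have c1 : {for z, continuous (fun z : RR * RR => 1 - z.1)}.
  by apply: continuous_subr; exact: cvg_fst.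
have c2 : {for z, continuous (fun z : RR * RR => z.2 / k)}.
  by apply: cvgM; [exact: cvg_snd|exact: cvg_cst].
exact: (cvg_pair c1 c2).
Qed.

(** Scaling keeps the angle and increases only the power term. This makes the region star-shaped
    about the centre. *)
Lemma level_scale_lt (alpha s : RR) w : 0 < alpha -> w != (0, 0) -> 1 < s ->
  level alpha (s * w.1, s * w.2) < level alpha w.
Proof.
move=> a0 w0 s1; have [th thpi ->] := polarP w0; have m0 := modulus_gt0 w0.
rewrite /= !mulrA !level_polar //; last by rewrite mulr_gt0 //; lra.
rewrite ltrD2l ltrN2 gt0_ltr_powR ?invr_gt0 ?nnegrE ?(ltW m0) ?mulr_ge0 //; nra.
Qed.

(** Since [alpha^-1 >= 1], a modulus of at least 2 has a power of at least 2, which no doubled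
    cosine exceeds. *)
Lemma level_gt0_modulus (alpha : RR) w : 0 < alpha < 1 -> 0 < level alpha w ->
  modulus w < 2.
Proof.
move=> /andP[a0 a1]; rewrite subr_gt0 => h; rewrite ltNge; apply/negP => m2.
have := cos_le1 (acos (w.1 / modulus w) / (2 - alpha)).
have : 2 `^ 1 <= modulus w `^ alpha^-1.
  apply: le_trans (ler_powR _ _) (ge0_ler_powR _ _ _ m2).
  - by lra.
  - by rewrite -[leLHS]invr1 lef_pV2 ?posrE // ltW.
  - by rewrite invr_ge0 ltW.
  - by rewrite nnegrE; lra.
  - by rewrite nnegrE modulus_ge0.
by rewrite powRr1; lra.
Qed.

(* The curve is the zero set of [level], together with the centre: [level] keeps its sign on connected sets missing the curve, and is negative along the outgoing ray from an exterior point. *)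
Lemma enclosed_level (alpha k : RR) (c : RR -> RR * RR) :
  0 < alpha < 1 -> k != 0 ->
  (forall t, c t = ((kern alpha t).1 + 1, (kern alpha t).2 * k)) ->
  forall z, enclosed c z <->
    recenter k z != (0, 0) /\ 0 < level alpha (recenter k z).
Proof.
move=> a01 k0 cE; have [a0 a1] := andP a01.
have imP z : curve_image c z <->
    recenter k z = (0, 0) \/ level alpha (recenter k z) = 0.
  rewrite -(kern_imageP _ _ a01); split=> -[t t02].
    move=> cz; exists t => //; rewrite -cz cE.
    by case: (kern alpha t) => x y /=; rewrite mulfK //; congr pair; ring.
  move=> kt; exists t => //; rewrite cE kt /= divfK //.
  by case: z {kt} => x y /=; rewrite opprB subrK.
have imN z : ~ curve_image c z <->
    recenter k z != (0, 0) /\ level alpha (recenter k z) != 0.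
  rewrite imP not_orP; split=> -[h1 h2].
    by split; apply/eqP.
  by split; apply/eqP.
move=> z; split.
  case=> /imN[w0 l0] [M Mb]; split=> //.
  rewrite lt_def l0 /= leNgt; apply/negP => lneg.
  (* The half-line from the centre [(1, 0)] through [z]; after [recenter] it is multiplication by
     [s]. *)
  pose ray (s : RR) : RR * RR := (1 - s * (1 - z.1), s * z.2).
  have recR s : recenter k (ray s) = (s * (recenter k z).1, s * (recenter k z).2).
    by rewrite /recenter /=; congr pair; ring.
  have ray1 : ray 1 = z.
    by rewrite /ray !mul1r subKr -surjective_pairing.
  have ray_sub : ray @` `[1, +oo[%classic `<=` connected_component (~` curve_image c) z.
    apply: connected_component_max.
    - by exists 1 => //=; rewrite in_itv /= lexx.
    - move=> _ [s + <-]; rewrite /= in_itv /= andbT => s1.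
      apply/imN; rewrite recR; split.
        move: w0; apply: contra; rewrite -!pair_eqE /pair_eq /fst /snd !mulf_eq0.
        by rewrite (gt_eqF (lt_le_trans ltr01 s1)).
      rewrite lt_eqF //; move: s1; rewrite le_eqVlt => /predU1P[<-|s1].
        by rewrite !mul1r -surjective_pairing.
      by apply: lt_trans lneg; exact: level_scale_lt.
    - apply: connected_continuous_connected.
        by apply/connected_intervalP; exact: interval_is_interval.
      apply: continuous_subspaceT => s.
      exact: continuous_affine_ray.
  have bnd s : 1 <= s -> `|1 - s * (1 - z.1)| <= M /\ `|s * z.2| <= M.
    move=> s1; apply: (Mb (ray s)); apply: ray_sub; exists s => //=.
    by rewrite in_itv /= s1.
  have M0 : 0 <= M by have [+ _] := bnd 1 (lexx 1); apply: le_trans.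
  (* The summand 2 leaves room for the 1 in the abscissa [1 - s * (1 - z.1)], so either nonzero
     coordinate contradicts the bound [M]. *)
  have big x : x != 0 -> exists2 s, 1 <= s & `|s * x| = M + 2 + `|x|.
    move=> x0; have nx : 0 < `|x| by rewrite normr_gt0.
    exists ((M + 2) / `|x| + 1).
      by rewrite lerDr divr_ge0 //; lra.
    rewrite normrM ger0_norm; last by rewrite addr_ge0 // divr_ge0 //; lra.
    by rewrite mulrDl mul1r divfK // gt_eqF.
  move: w0; rewrite -pair_eqE /= negb_and mulf_eq0 invr_eq0 (negbTE k0) orbF.
  case/orP=> /big[s s1 sE]; have [b1 b2] := bnd s s1.
    have := ler_normB 1 (1 - s * (1 - z.1)).
    have := normr_ge0 (1 - z.1).
    by rewrite subKr sE normr1; lra.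
  by move: b2; rewrite sE; have := normr_ge0 z.2; lra.
case=> w0 lpos; split; first by apply/imN; rewrite gt_eqF.
set C := connected_component _ z.
have Csub : C `<=` ~` curve_image c by exact: connected_component_sub.
have Cz : C z.
  by apply: connected_component_refl; apply/imN; rewrite gt_eqF.
have Cpos y : C y -> 0 < level alpha (recenter k y).
  move=> Cy; have /imN[y0 ly0] := Csub _ Cy.
  rewrite ltNge; apply/negP => yneg.
  (* A change of sign on [C] would force a zero of the level, that is, a point of the curve in
     [C]. *)
  have : connected ((level alpha \o recenter k) @` C).
    apply: connected_continuous_connected; first exact: component_connected.
    apply: continuous_in_subspaceT => x /set_mem Cx.
    apply: continuous_comp; first exact: recenter_continuous.
    by apply: level_continuous; have /imN[] := Csub _ Cx.
  move=> /connected_intervalP /(_ (level alpha (recenter k y)) (level alpha (recenter k z))).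
  case/(_ _ _ 0) => [||| x Cx /= /eqP].
  - by exists y.
  - by exists z.
  - by rewrite yneg ltW.
  - by apply/negP; have /imN[] := Csub _ Cx.
exists (1 + 2 * (1 + `|k|)) => y /Cpos ly.
have m2 := level_gt0_modulus a01 ly.
have /= := norm_fst_le_modulus (recenter k y).
have /= := norm_snd_le_modulus (recenter k y).
have k_ge0 := normr_ge0 k.
rewrite normrM normfV ler_pdivrMr ?normr_gt0 // => h2 h1; split.
  rewrite -[y.1](subKr 1).
  by apply: le_trans (ler_normB _ _) _; rewrite normr1; lra.
apply: le_trans h2 _; nra.
Qed.

(** * The spectrum of the circulant matrix *)

Definition cis (t : RR) : complex RR := Complex (cos t) (sin t).

Lemma cisD s t : cis (s + t) = cis s * cis t.
Proof. by rewrite /cis trigo.cosD trigo.sinD; congr Complex; ring. Qed.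

Lemma cis0 : cis 0 = 1.
Proof. by rewrite /cis cos0 sin0. Qed.

Lemma cis_neq0 t : cis t != 0.
Proof.
apply/eqP => t0; have := cisD t (- t); rewrite subrr cis0 t0 mul0r => /eqP.
by rewrite oner_eq0.
Qed.

Lemma cisV t : (cis t)^-1 = cis (- t).
Proof. by apply: (mulfI (cis_neq0 t)); rewrite divff ?cis_neq0 // -cisD subrr cis0. Qed.

Lemma cisX t n : cis t ^+ n = cis (n%:R * t).
Proof.
elim: n => [|n IHn]; first by rewrite mul0r cis0.
by rewrite exprS IHn -cisD -natr1 mulrDl mul1r addrC.
Qed.

Definition root_angle (N k : nat) : RR := 2 * pi * k%:R / N%:R.

Lemma cis_root_angleX N k : (0 < N)%N -> cis (root_angle N k) ^+ N = 1.
Proof.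
move=> N0; rewrite cisX /root_angle mulrC divfK; last by rewrite pnatr_eq0 -lt0n.
elim: k => [|k IHk]; first by rewrite mulr0 cis0.
rewrite -[k.+1]addn1 natrD mulrDr mulr1 cisD IHk mul1r mulrC mulr_natr.
by rewrite /cis cos2pi sin2pi.
Qed.

(** Half the difference of the angles lies strictly between 0 and [pi], so its sine is nonzero and
    the cosine of the difference is below 1. *)
Lemma cis_root_angle_inj N i j : (i < j < N)%N ->
  cis (root_angle N i) != cis (root_angle N j).
Proof.
move=> /andP[ij jN]; have N0 : 0 < N%:R :> RR by rewrite ltr0n; apply: leq_trans jN.
apply/eqP => e; pose d : RR := root_angle N j - root_angle N i.
have d1 : cis d = 1 by rewrite /d cisD -cisV -e divff ?cis_neq0.
have : cos d = 1 by move: d1 => [].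
have dE : d / 2 = pi * ((j%:R - i%:R) / N%:R).
  by rewrite /d /root_angle; field; rewrite gt_eqF.
have ijR : i%:R < j%:R :> RR by rewrite ltr_nat.
have jNR : j%:R < N%:R :> RR by rewrite ltr_nat.
have i0 : 0 <= i%:R :> RR by exact: ler0n.
have q0 : 0 < (j%:R - i%:R) / N%:R :> RR by rewrite divr_gt0 //; lra.
have q1 : (j%:R - i%:R) / N%:R < 1 :> RR by rewrite ltr_pdivrMr // mul1r; lra.
have pi0 := pi_gt0 RR.
have s0 : 0 < sin (d / 2) by apply: sin_gt0_pi; rewrite dE; nra.
by rewrite cos_double_half; have := exprn_gt0 2 s0; lra.
Qed.


Lemma ordS_val N (i : 'I_N) : ordS i = (if i.+1 == N then 0 else i.+1)%N :> nat.
Proof.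
rewrite /=; case: eqP => [->|/eqP ne]; first by rewrite modnn.
by rewrite modn_small // ltn_neqAle ne ltn_ord.
Qed.

Lemma eq_ord_pred N (i j : 'I_N) : (j == ord_pred i) = (i == ordS j).
Proof. by rewrite -(inj_eq (can_inj (@ordSK N))) ord_predK eq_sym. Qed.

(** For [N >= 3] an index and its two cyclic neighbours are distinct, so the nested tests become
    independent indicators. *)
Lemma Amat_entryE N (a0 a1 a2 : RR) (i j : 'I_N) : (3 <= N)%N ->
  Amat N a0 a1 a2 i j =
  a1 * (j == i)%:R + a2 * (j == ordS i)%:R + a0 * (j == ord_pred i)%:R.
Proof.
move=> N3.
have ordS_asym (k l : 'I_N) : k = ordS l -> l = ordS k -> False.
  move=> /(congr1 val); rewrite /= -/(val _) => ek /(congr1 val) el.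
  have := ordS_val l; have := ordS_val k; rewrite /= in ek el *; rewrite -ek -el.
  have := ltn_ord k; have := ltn_ord l.
  by do 2 case: eqP; lia.
have ordS_neq (k : 'I_N) : k <> ordS k by move=> ek; exact: (ordS_asym k k).
have SE (k l : 'I_N) : ((k : nat) == (modn l.+1 N)) = (k == ordS l) by [].
rewrite mxE (gtn_eqF (ltnW N3)) (gtn_eqF N3) !SE.
rewrite eq_ord_pred -[(j : nat) == i]/(j == i).
have [->|ji] := eqVneq j i.
  by move/eqP/negbTE: (ordS_neq i) => ->; rewrite !mulr0 !addr0 mulr1.
have [jS|jS] := eqVneq j (ordS i).
  have [iS|_] := eqVneq i (ordS j); first by case: (ordS_asym i j iS jS).
  by rewrite !mulr0 addr0 add0r mulr1.
by case: eqP; rewrite !(mulr0, mulr1) !add0r.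
Qed.

Lemma Amat_transpose_entry N (a0 a1 a2 : RR) (i j : 'I_N) : (3 <= N)%N ->
  Amat N a0 a1 a2 i j = Amat N a2 a1 a0 j i.
Proof.
by move=> N3; rewrite !Amat_entryE // !eq_ord_pred [i == j]eq_sym addrAC.
Qed.

(** As [z ^+ N = 1], the cyclic shift multiplies the vector of powers by [z], so each row of the
    matrix acts through the symbol of the circulant. *)
Lemma Amat_mul_powers N (a0 a1 a2 : RR) (z : complex RR) (i : 'I_N) :
  (3 <= N)%N -> z ^+ N = 1 ->
  \sum_j real_complex RR (Amat N a0 a1 a2 i j) * z ^+ j =
  (real_complex RR a1 + real_complex RR a2 * z + real_complex RR a0 / z) * z ^+ i.
Proof.
move=> N3 zN.
have z0 : z != 0.
  apply/eqP => z0; move: zN; rewrite z0 expr0n gtn_eqF ?(leq_trans _ N3) //.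
  by move/eqP; rewrite eq_sym oner_eq0.
have sum_delta (c : complex RR) (k : 'I_N) :
    \sum_(j < N) c * (j == k)%:R * z ^+ j = c * z ^+ k.
  rewrite (bigD1 k) //= eqxx mulr1 big1 ?addr0 // => j /negbTE ->.
  by rewrite mulr0 mul0r.
have zS (k : 'I_N) : z ^+ ordS k = z * z ^+ k.
  rewrite ordS_val -exprS; case: eqP => // kN.
  by rewrite kN zN expr0.
have zP : z ^+ ord_pred i = z^-1 * z ^+ i.
  by rewrite -[in RHS](ord_predK i) zS mulKf.
under eq_bigr => j _.
  rewrite Amat_entryE // !rmorphD !rmorphM /= !rmorph_nat !mulrDl.
  over.
rewrite !big_split /= !sum_delta zS zP; ring.
Qed.

Lemma antisymmetric_symbol (a1 a2 t : RR) :
  real_complex RR a1 + real_complex RR a2 * cis t + real_complex RR (- a2) / cis t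
  = Complex a1 (2 * a2 * sin t).
Proof.
rewrite cisV /cis cosN sinN; apply/eqP; rewrite eq_complex /=.
by apply/andP; split; apply/eqP; ring.
Qed.

(* The powers [cis (root_angle N k) ^+ j] form a right eigenvector of [A]; the test of a left eigenvector [v] against all of them evaluates the polynomial with coefficients [v] at all the [N]-th roots of unity. *)
Lemma eigenvalue_AmatP N (a1 a2 : RR) (l : complex RR) : (3 <= N)%N ->
  is_eigenvalue (Amat N (- a2) a1 a2) l <->
  exists2 k : nat, (k < N)%N & l = Complex a1 (2 * a2 * sin (root_angle N k)).
Proof.
move=> N3; have N0 : (0 < N)%N by apply: leq_trans N3.
rewrite /is_eigenvalue; set B := map_mx _ _.
have BE i j : B i j = real_complex RR (Amat N (- a2) a1 a2 i j) by rewrite mxE.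
split; last first.
  (* [eigenvalue] acts on row vectors, so the matrix is transposed, which exchanges [a2] and [- a2];
     the opposite angle compensates. *)
  case=> k _ ->; pose z := cis (- root_angle N k).
  have zN : z ^+ N = 1 by rewrite /z -cisV exprVn cis_root_angleX // invr1.
  apply/eigenvalueP; exists (\row_j z ^+ j).
    apply/rowP => j; rewrite !mxE.
    under eq_bigr => i _.
      rewrite mxE BE mulrC Amat_transpose_entry //.
      over.
    rewrite Amat_mul_powers //; congr (_ * _).
    have := antisymmetric_symbol a1 (- a2) (- root_angle N k); rewrite opprK => ->.
    by rewrite sinN; congr Complex; ring.
  apply/eqP => /rowP/(_ (Ordinal N0)); rewrite !mxE expr0 => /eqP.
  by rewrite oner_eq0.
case/eigenvalueP => v vB v0.
pose p := rVpoly v.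
have pE z : p.[z] = \sum_(i < N) v 0 i * z ^+ i.
  rewrite /p horner_poly; apply: eq_bigr => i _.
  by rewrite insubT //= => iN; congr (v 0 _ * _); exact: val_inj.
pose zs := [seq cis (root_angle N k) | k <- iota 0 N].
have zs_uniq : uniq zs.
  rewrite map_inj_in_uniq ?iota_uniq // => i j.
  rewrite !mem_iota !add0n /= => iN jN e.
  by case: (ltngtP i j) => // ij;
    [have := @cis_root_angle_inj N i j|have := @cis_root_angle_inj N j i];
    rewrite ij ?iN ?jN e eqxx => /(_ isT).
have p0 : p != 0.
  by apply: contra v0 => /eqP p0; rewrite -[v]rVpolyK -/p p0 linear0.
(* A nonzero polynomial of degree below [N] cannot vanish at [N] distinct points. *)
have : ~~ all (root p) zs.
  apply/negP => rp; have := max_poly_roots p0 rp zs_uniq.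
  by rewrite size_map size_iota ltnNge size_poly.
case/allPn => _ /mapP[k + ->]; rewrite mem_iota add0n /= => kN.
set z := cis _ => pz; exists k => //.
(* Pairing [v *m B] with the powers of [z] gives both [l * p.[z]] and the symbol times [p.[z]]; the
   nonzero factor cancels. *)
rewrite -antisymmetric_symbol -/z; apply: (mulIf pz).
rewrite pE mulr_sumr.
transitivity (\sum_(j < N) (v *m B) 0 j * z ^+ j).
  by rewrite vB; apply: eq_bigr => j _; rewrite mxE mulrA.
under eq_bigr => j _ do rewrite mxE mulr_suml.
rewrite exchange_big mulr_sumr; apply: eq_bigr => i _ /=.
rewrite mulrCA -Amat_mul_powers ?cis_root_angleX // mulr_sumr.
by apply: eq_bigr => j _; rewrite BE mulrA.
Qed.

(** * Stability *)

Lemma ler_cos (R : realType) : {in `[0, pi]%R &, {mono (@cos R) : x y /~ y <= x}}.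
Proof. by move=> x y xpi ypi /=; rewrite !leNgt ltr_cos. Qed.

(** To the right of the centre the angle is 0; to the left it is [pi], and [pi / (2 - alpha)] falls
    in [[pi / 2, pi]], where cosine is not positive. *)
Lemma level_real_axis (alpha u : RR) : 0 < alpha < 1 ->
  (u, 0 : RR) != (0, 0) /\ 0 < level alpha (u, 0) <-> 0 < u < 2 `^ alpha.
Proof.
move=> /andP[a0 a1]; have ia0 : 0 < alpha^-1 by rewrite invr_gt0.
have pow2 : (2 `^ alpha) `^ alpha^-1 = 2 :> RR.
  by rewrite -powRrM divff ?gt_eqF // powRr1 //; lra.
have pos (v : RR) : 0 < v -> level alpha (v, 0) = 2 - v `^ alpha^-1.
  move=> v0; have := level_polar alpha v0 (theta := 0).
  rewrite normr0 cos0 sin0 mul0r cos0 mulr0 !mulr1; apply; exact: pi_ge0.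
rewrite xpair_eqE eqxx andbT.
have [u0|u0|->] := ltgtP u 0.
- split=> //; case=> _; rewrite ltNge => /negP[].
  have nu0 : 0 < - u by lra.
  have := level_polar alpha nu0 (theta := pi).
  rewrite cospi sinpi mulr0 mulrN1 opprK ger0_norm ?pi_ge0 // lexx => -> //.
  have pi0 := pi_gt0 RR; have b0 : 0 < 2 - alpha by lra.
  have : 0 <= sin (pi / (2 - alpha) - pi / 2) :> RR.
    apply: sin_ge0_pi; rewrite lerBlDr lerBrDr add0r.
    rewrite ler_pdivlMr // ler_pdivrMr //; nra.
  rewrite sinBpihalf; have := powR_ge0 (- u) alpha^-1; lra.
- rewrite pos // subr_gt0; split=> [[_ h]|h].
    rewrite ltNge; apply/negP => h2; move: h.
    rewrite -pow2 ltNge ge0_ler_powR ?nnegrE ?powR_ge0 ?(ltW ia0) ?(ltW u0) //.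
  split=> //; rewrite -pow2.
  by rewrite gt0_ltr_powR ?nnegrE ?powR_ge0 ?(ltW u0).
- by split=> [[]|].
Qed.

(* Lowering [|v|] brings the point closer to the centre and its direction closer to the axis of symmetry, and [level] decreases in both quantities. *)
Lemma level_vertical (alpha u v v' : RR) : 0 < alpha < 1 -> 0 < u -> `|v'| <= `|v| ->
  level alpha (u, v) <= level alpha (u, v').
Proof.
move=> /andP[a0 a1] u0 vv; have b0 : 0 < 2 - alpha by lra.
have w0 (x : RR) : (u, x) != (0, 0) by rewrite xpair_eqE gt_eqF.
have mle : modulus (u, v') <= modulus (u, v).
  apply: ler_wsqrtr => /=; rewrite lerD2l.
  rewrite -(real_normK (num_real v')) -(real_normK (num_real v)).
  by rewrite lerXn2r // nnegrE.
have m0 := modulus_gt0 (w0 v'); have m1 := modulus_gt0 (w0 v).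
rewrite /level /=.
have b := fst_div_modulus_bound (u, v); have b' := fst_div_modulus_bound (u, v').
have := acos_ge0 b; have := acos_lepi b; have := acos_ge0 b'; have := acos_lepi b'.
have : acos (u / modulus (u, v')) <= acos (u / modulus (u, v)).
  rewrite -ler_cos ?in_itv /= ?acos_ge0 ?acos_lepi //.
  rewrite !acosK ?in_itv //= ler_pM2l // lef_pV2 //.
set th := acos _; set th' := acos _ => thth t1 t2 t3 t4.
have th_itv (x : RR) : 0 <= x <= pi -> x / (2 - alpha) \in `[0, pi]%R.
  move=> /andP[x0 xpi]; rewrite in_itv /= divr_ge0 ?(ltW b0) //= ler_pdivrMr //; nra.
apply: lerB.
  rewrite ler_pM2l // ler_cos ?th_itv ?t1 ?t2 ?t3 ?t4 //.
  by rewrite ler_pM2r ?invr_gt0.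
by apply: ge0_ler_powR; rewrite ?nnegrE ?invr_ge0 ?(ltW a0) ?(ltW m0) ?(ltW m1).
Qed.

(** In units of [pi / (2 * N)] the root angle is [4 * k] and a right angle is [N]; the disjunction
    says that [n] is their distance, avoiding truncated subtraction. *)
Lemma sin_root_angle N k n : (0 < N)%N ->
  (n + 4 * k == N)%N || (n + N == 4 * k)%N ->
  sin (root_angle N k) = cos (pi * n%:R / (2 * N%:R)) :> RR.
Proof.
move=> N0 nk; have NR : N%:R != 0 :> RR by rewrite pnatr_eq0 -lt0n.
rewrite -cosBpihalf /root_angle; case/orP: nk => /eqP/(congr1 (fun m => m%:R : RR)).
  rewrite natrD natrM => e; rewrite -cosN; congr cos.
  by have -> : n%:R = N%:R - 4 * k%:R :> RR; [lra|field].
rewrite natrD natrM => e; congr cos.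
by have -> : n%:R = 4 * k%:R - N%:R :> RR; [lra|field].
Qed.

(** The same measurement from three right angles, where the sine is -1. *)
Lemma sin_root_angle_opp N k n : (0 < N)%N ->
  (n + 4 * k == 3 * N)%N || (n + 3 * N == 4 * k)%N ->
  sin (root_angle N k) = - cos (pi * n%:R / (2 * N%:R)) :> RR.
Proof.
move=> N0 nk; have NR : N%:R != 0 :> RR by rewrite pnatr_eq0 -lt0n.
rewrite -cosBpihalf /root_angle -cosDpi; case/orP: nk => /eqP/(congr1 (fun m => m%:R : RR)).
  rewrite natrD !natrM => e; rewrite -cosN -[LHS]cosD2pi; congr cos.
  rewrite mulr2n.
  have -> : n%:R = 3 * N%:R - 4 * k%:R :> RR by lra.
  by field.
rewrite natrD !natrM => e; congr cos.
by have -> : n%:R = 4 * k%:R - 3 * N%:R :> RR; [lra|field].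
Qed.

Lemma cos_quarter_le (d n N : nat) : (0 < N)%N -> (d <= n <= N)%N ->
  0 <= cos ((pi : RR) * n%:R / (2 * N%:R)) <= cos (pi * d%:R / (2 * N%:R)).
Proof.
move=> N0 /andP[dn nN]; have pi0 := pi_gt0 RR.
have NR : 0 < N%:R :> RR by rewrite ltr0n.
have q (m : nat) : (m <= N)%N -> 0 <= (pi : RR) * m%:R / (2 * N%:R) <= pi / 2.
  move=> mN; have mR : m%:R <= N%:R :> RR by rewrite ler_nat.
  have m0 : 0 <= m%:R :> RR by exact: ler0n.
  have N2 : 0 < 2 * N%:R :> RR by lra.
  apply/andP; split; first by rewrite divr_ge0 ?mulr_ge0 ?(ltW pi0) ?(ltW N2).
  by rewrite ler_pdivrMr //; nra.
have /andP[n0 n1] := q n nN; have /andP[d0 d1] := q d (leq_trans dn nN).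
rewrite cos_ge0_pihalf /=; last by lra.
rewrite ler_cos ?in_itv /=; try lra.
by rewrite ler_pM2r ?invr_gt0 ?mulr_gt0 // ler_pM2l // ler_nat.
Qed.

Lemma norm_sin_root_angle_le N d k : (0 < N)%N -> (k < N)%N ->
  (forall n k : nat,
     (n + 4 * k == N)%N || (n + N == 4 * k)%N ||
     (n + 4 * k == 3 * N)%N || (n + 3 * N == 4 * k)%N -> (d <= n)%N) ->
  `|sin (root_angle N k)| <= cos (pi * d%:R / (2 * N%:R)) :> RR.
Proof.
move=> N0 kN dmin.
(* Each quadrant is within [N] units of [N] or of [3 * N]. *)
have [n nN /orP nk] : exists2 n : nat, (n <= N)%N &
    ((n + 4 * k == N)%N || (n + N == 4 * k)%N) ||
    ((n + 4 * k == 3 * N)%N || (n + 3 * N == 4 * k)%N).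
  case: (leqP (4 * k) N) => h1; first by exists (N - 4 * k)%N; lia.
  case: (leqP (2 * k) N) => h2; first by exists (4 * k - N)%N; lia.
  case: (leqP (4 * k) (3 * N)) => h3; first by exists (3 * N - 4 * k)%N; lia.
  by exists (4 * k - 3 * N)%N; lia.
have dn : (d <= n)%N by apply: (dmin n k); rewrite -orbA; apply/orP.
have dnN : (d <= n <= N)%N by rewrite dn.
have /andP[c0 cd] := cos_quarter_le N0 dnN.
case: nk => nk.
  by rewrite (sin_root_angle N0 nk) ger0_norm.
by rewrite (sin_root_angle_opp N0 nk) normrN ger0_norm.
Qed.

Lemma is_eigenvalue_scalar N (a : RR) (l : complex RR) : (0 < N)%N ->
  is_eigenvalue (a%:M : 'M[RR]_N) l <-> l = real_complex RR a.
Proof.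
move=> N0; rewrite /is_eigenvalue map_scalar_mx; split=> [/eigenvalueP[v]|->].
  rewrite mul_mx_scalar => vl v0; apply/eqP; rewrite -subr_eq0; apply: contraR v0 => la.
  have /eqP : (l - real_complex RR a) *: v = 0 by rewrite scalerBl vl subrr.
  by rewrite scaler_eq0 (negbTE la).
apply/eigenvalueP; exists (const_mx 1); first by rewrite mul_mx_scalar.
by apply/eqP => /rowP/(_ (Ordinal N0)); rewrite !mxE => /eqP; rewrite oner_eq0.
Qed.

(** * The stable regions in each dimension *)

Lemma OmegaP (alpha x y : RR) : 0 < alpha < 1 ->
  Omega alpha (x, y) <-> (1 - x, y) != (0, 0) /\ 0 < level alpha (1 - x, y).
Proof.
move=> a01; rewrite /Omega (@enclosed_level alpha 1) ?oner_eq0 //.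
  by rewrite /recenter /= divr1.
by move=> t; rewrite mulr1 addrC.
Qed.

Lemma Omega_real (alpha x : RR) : 0 < alpha < 1 ->
  Omega alpha (x, 0) <-> 1 - 2 `^ alpha < x < 1.
Proof. by move=> a01; rewrite OmegaP // level_real_axis //; split; lra. Qed.

(** With [a0 = - a2] the off-diagonal contributions cancel, and the matrix is the scalar [a1]. *)
Lemma stable_region_small (alpha : RR) N (a1 a2 : RR) : 0 < alpha < 1 ->
  (N == 1)%N || (N == 2)%N ->
  stable_region alpha N (a1, a2) <-> 1 - 2 `^ alpha < a1 < 1.
Proof.
move=> a01 N12; have N0 : (0 < N)%N by case/orP: N12 => /eqP ->.
have AE : Amat N (- a2) a1 a2 = a1%:M.
  apply/matrixP => i j; rewrite !mxE.
  case/orP: N12 i j => /eqP -> i j /=; first by rewrite !ord1 eqxx addrAC addNr add0r.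
  by rewrite addNr; case: eqP.
rewrite -Omega_real //; split=> [st|st l].
  by apply: (st (real_complex RR a1)); rewrite /= AE; apply/(is_eigenvalue_scalar _ _ N0).
by rewrite /= AE => /(is_eigenvalue_scalar _ _ N0) ->.
Qed.

(** Here [d] is the distance of [4 * j] from [N]. Its minimality makes [j] a maximiser of the
    absolute sine, and [d < N] makes that sine positive. *)
Lemma stable_region_large (alpha : RR) (N j d : nat) (a1 a2 : RR) :
  0 < alpha < 1 -> (3 <= N)%N -> (j < N)%N -> (d < N)%N ->
  (d + 4 * j == N)%N || (d + N == 4 * j)%N ->
  (forall n k : nat,
     (n + 4 * k == N)%N || (n + N == 4 * k)%N ||
     (n + 4 * k == 3 * N)%N || (n + 3 * N == 4 * k)%N -> (d <= n)%N) ->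
  stable_region alpha N (a1, a2) <-> a1 < 1 /\ enclosed (gamma alpha N j) (a1, a2).
Proof.
move=> a01 N3 jN dN dj dmin; have N0 : (0 < N)%N by apply: leq_trans N3.
have sE := sin_root_angle N0 dj.
have s0 : 0 < sin (root_angle N j).
  rewrite sE; apply: cos_gt0_pihalf; have pi0 := pi_gt0 RR.
  have NR : 0 < N%:R :> RR by rewrite ltr0n.
  have dR : d%:R < N%:R :> RR by rewrite ltr_nat.
  have d0 : 0 <= d%:R :> RR by exact: ler0n.
  have : 0 <= pi * d%:R / (2 * N%:R) :> RR by rewrite divr_ge0 ?mulr_ge0 ?(ltW pi0) ?(ltW NR).
  have : pi * d%:R / (2 * N%:R) < pi / 2 :> RR.
    by rewrite ltr_pdivrMr ?mulr_gt0 //; nra.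
  lra.
have gammaP : enclosed (gamma alpha N j) (a1, a2) <->
    Omega alpha (a1, 2 * a2 * sin (root_angle N j)).
  rewrite OmegaP // (@enclosed_level alpha (2 * sin (root_angle N j))^-1) //.
  - rewrite /recenter /= invrK; set s := sin _.
    by have -> : a2 * (2 * s) = 2 * a2 * s by ring.
  - by rewrite invr_eq0 mulf_neq0 ?gt_eqF.
rewrite gammaP; split.
  move=> st; have eig k : (k < N)%N -> Omega alpha (a1, 2 * a2 * sin (root_angle N k)).
    move=> kN; apply: (st (Complex a1 (2 * a2 * sin (root_angle N k)))).
    by apply/eigenvalue_AmatP => //; exists k.
  split; last exact: eig.
  (* The index 0 gives the real eigenvalue [a1]. *)
  have := eig 0 N0; rewrite /root_angle mulr0 mul0r sin0 mulr0.
  by rewrite Omega_real // => /andP[].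
move=> [a11 /OmegaP Om] l /= /eigenvalue_AmatP[] // k kN -> /=.
have [_ lpos] := Om a01.
apply/OmegaP => //; split.
  by rewrite xpair_eqE gt_eqF //; lra.
(* All eigenvalues share the real part [a1], so the one with the largest imaginary modulus controls
   the others. *)
apply: lt_le_trans lpos _; apply: level_vertical => //; first by lra.
rewrite !normrM ler_wpM2l ?mulr_ge0 // [leRHS]gtr0_norm // sE.
exact: norm_sin_root_angle_le.
Qed.

Theorem theorem4 (alpha : Rdefinitions.R) (halpha : 0 < alpha < 1) :
  (forall N : nat, (N == 1)%N || (N == 2)%N ->
     forall a1 a2 : Rdefinitions.R,
       stable_region alpha N (a1, a2) <-> 1 - 2 `^ alpha < a1 < 1)
  /\
  (forall N : nat, (3 <= N)%N -> odd N ->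
     forall a1 a2 : Rdefinitions.R,
       stable_region alpha N (a1, a2) <->
       a1 < 1 /\ enclosed (gamma alpha N ((N - 1 + 3) %/ 4)) (a1, a2))
  /\
  (forall N : nat, (4 <= N)%N -> ~~ odd N ->
     forall a1 a2 : Rdefinitions.R,
       stable_region alpha N (a1, a2) <->
       a1 < 1 /\ enclosed (gamma alpha N (N %/ 4)) (a1, a2)).
Proof.
split; [|split] => N.
- by move=> N12 a1 a2; exact: stable_region_small.
(* The quotient is the ceiling of [(N - 1) / 4], so [4 * j] is [N - 1] or [N + 1]; distance 0 is
   impossible by parity. *)
- by move=> N3 Nodd a1 a2; apply: (@stable_region_large _ _ _ 1) => // *; lia.
- move=> N4 Neven a1 a2.
  (* If 4 divides [N], the angle [pi / 2] is attained; otherwise [N] and [3 * N] are 2 modulo 4, at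
     distance at least 2 from multiples of 4. *)
  apply: (@stable_region_large _ _ _ (if (4 %| N)%N then 0 else 2)%N) => //.
  + by lia.
  + by lia.
  + by case: ifP; lia.
  + by case: ifP; lia.
  + by move=> n k; case: ifP; lia.
Qed.
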